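(* The abc-conjecture is equivalent to the assertion that, for every $\varepsilon>0$, $$q_{\mathrm{DGM}}(a,b,c)\le\frac{1+\varepsilon}{\eta(a,b,c)}$$ for all but finitely many abc-triples $(a,b,c)$. Thus, the abc-conjecture implies that for every $\varepsilon>0$ and all but finitely many abc-triples, with $P=P(abc)$ the largest prime dividing $abc$, $$q_{\mathrm{DGM}}(a,b,c)\le(1+\varepsilon)\,S\!\left(\frac{\ln P}{\ln 2}\right)=(1+\varepsilon)\,\frac{\ln P}{e\,\ln 2\cdot\ln\ln P}\,(1+o(1)),$$ so that $q_{\mathrm{DGM}}\in\mathcal{O}\big(\ln P(abc)/\ln\ln P(abc)\big)$.
   Context: An abc-triple is a triple $(a,b,c)$ of positive integers with $a+b=c$ and $\gcd(a,b)=\gcd(b,c)=\gcd(a,c)=1$; $\omega=\omega(abc)$ is the number of distinct primes $p_1,\dots,p_{\omega}$ dividing $abc$; $\mathrm{rad}(n)$ is the product of the distinct primes dividing $n$. The standard quality is $q_s(a,b,c)=\ln c/\ln(\mathrm{rad}(abc))$. The abc-conjecture: for every real $\varepsilon>0$ there are only finitely many abc-triples with $q_s(a,b,c)>1+\varepsilon$. The DGM quality is $q_{\mathrm{DGM}}(a,b,c)=\ln c/\ln(\mathrm{DGM}(\{p^\omega:p\mid abc,\ p\text{ prime}\}))$ with $\mathrm{DGM}(\{x_1,\dots,x_m\})=\exp(\exp(\tfrac1m\sum_i\ln\ln x_i))$; equivalently $q_{\mathrm{DGM}}(a,b,c)=\ln c\,\big/\,\big(\omega(\prod_{i=1}^{\omega}\ln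 p_i)^{1/\omega}\big)$. The packing efficiency is $\eta(a,b,c)=G/A$, where $A=\frac1\omega\sum_{i=1}^\omega\ln p_i$ and $G=\big(\prod_{i=1}^\omega\ln p_i\big)^{1/\omega}$. The Specht ratio is $S(h)=\dfrac{(h-1)\,h^{1/(h-1)}}{e\ln h}$ for $h>1$, and $S(1)=1$. The $o(1)$ term is as $P\to\infty$. *)

(* Defs.v *)
From HB Require Import structures.
From mathcomp Require Import all_boot all_order all_algebra.
From mathcomp Require Import all_classical all_reals all_analysis.

Set Implicit Arguments.
Unset Strict Implicit.
Unset Printing Implicit Defensive.

Import Order.TTheory GRing.Theory Num.Theory.
Import numFieldNormedType.Exports.

Local Open Scope classical_set_scope.
Local Open Scope ring_scope.

Definition abc_triple (a b c : nat) : Prop :=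
  [/\ [&& 0 < a, 0 < b & 0 < c]%N,
      (a + b = c)%N
    & [&& coprime a b, coprime b c & coprime a c] ].

Definition almost_all_abc_triples (Q : nat -> nat -> nat -> Prop) : Prop :=
  finite_set [set t : nat * nat * nat |
    abc_triple t.1.1 t.1.2 t.2 /\ ~ Q t.1.1 t.1.2 t.2].

Definition omega (n : nat) : nat := size (primes n).

Definition rad (n : nat) : nat := (\prod_(p <- primes n) p)%N.

Section Quality.
Variable R : realType.

Definition standard_quality (a b c : nat) : R :=
  ln c%:R / ln (rad (a * b * c))%:R.

Definition abc_conjecture : Prop :=
  forall eps : R, 0 < eps ->
    finite_set [set t : nat * nat * nat |
      abc_triple t.1.1 t.1.2 t.2 /\
      1 + eps < standard_quality t.1.1 t.1.2 t.2].

(* Only meaningful when all entries of s are greater than 1. *)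
Definition DGM (s : seq R) : R :=
  expR (expR ((size s)%:R^-1 * \sum_(x <- s) ln (ln x))).

Definition DGM_quality (a b c : nat) : R :=
  let n := (a * b * c)%N in
  ln c%:R / ln (DGM [seq p%:R ^+ omega n | p <- primes n]).

Definition log_arithmetic_mean (n : nat) : R :=
  (omega n)%:R^-1 * \sum_(p <- primes n) ln p%:R.

Definition log_geometric_mean (n : nat) : R :=
  (\prod_(p <- primes n) ln p%:R) `^ (omega n)%:R^-1.

Definition packing_efficiency (a b c : nat) : R :=
  let n := (a * b * c)%N in log_geometric_mean n / log_arithmetic_mean n.

(* Only meaningful when 1 <= h. *)
Definition specht_ratio (h : R) : R :=
  if h == 1 then 1
  else (h - 1) * h `^ (h - 1)^-1 / (expR 1 * ln h).

(* The real number P(abc), where P(n) is the largest prime divisor of n;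
   abc is even for every abc-triple, so max_pdiv does not take its
   default value there. *)
Definition largest_prime (a b c : nat) : R := (max_pdiv (a * b * c))%:R.

End Quality.

Arguments standard_quality R a b c : clear implicits.
Arguments abc_conjecture R : clear implicits.
Arguments DGM_quality R a b c : clear implicits.
Arguments packing_efficiency R a b c : clear implicits.
Arguments largest_prime R a b c : clear implicits.

(* Main.v *)
(** For an abc-triple let A and G be the arithmetic and geometric means of the
    logarithms of the primes dividing abc, and w their number. Then
    ln (rad (abc)) = w A, while the double exponential mean of the p ^ w has
    logarithm w G, so that q_DGM = q_s / eta triple by triple: the two
    finiteness assertions are about the same sets. Specht's inequality, applied
    to logarithms lying between ln 2 and ln P, bounds 1 / eta = A / G by
    S (ln P / ln 2). With h = ln x / ln 2 the relative error in the asymptotic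
    form of S is
    (1 - 1 / h) h ^ (1 / (h - 1)) (1 + ln (ln 2) / ln h) - 1, which tends to 0. *)
Require Import Defs.
From HB Require Import structures.
From mathcomp Require Import all_boot all_order all_algebra.
From mathcomp Require Import all_classical all_reals all_analysis.
From mathcomp Require Import ring lra.

Set Implicit Arguments.
Unset Strict Implicit.
Unset Printing Implicit Defensive.

Import Order.TTheory GRing.Theory Num.Theory.
Import numFieldNormedType.Exports.

Local Open Scope classical_set_scope.
Local Open Scope ring_scope.

(** * Specht's reverse AM-GM inequality for finite sequences of positive reals *)

Section Specht.
Variable R : realType.
Implicit Types (x h m M : R) (s : seq R).

Lemma ln_prod (I : eqType) (s : seq I) (F : I -> R) :
  (forall i, i \in s -> 0 < F i) ->
  ln (\prod_(i <- s) F i) = \sum_(i <- s) ln (F i).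
Proof.
elim: s => [|i s IHs] F_gt0; first by rewrite !big_nil ln1.
have Fs_gt0 j : j \in s -> 0 < F j.
  by move=> js; apply: F_gt0; rewrite inE js orbT.
rewrite !big_cons lnM ?posrE ?IHs//; first by apply: F_gt0; rewrite mem_head.
by rewrite big_seq_cond prodr_gt0// => j /andP[/Fs_gt0].
Qed.

Lemma ln_le_subr1 x : 0 < x -> ln x <= x - 1.
Proof.
by move=> x_gt0; rewrite -{1}(subrK 1 x) addrC le_ln1Dx//; lra.
Qed.

(* Average the tangent bounds ln (h / x) <= h / x - 1 and ln (1 / x) <= 1 / x - 1
   with the weights (x - 1) / (h - 1) and (h - x) / (h - 1). *)
Lemma ln_chord_le h x : 1 < h -> 1 <= x <= h ->
  x <= 1 + (h - 1) / ln h * ln x.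
Proof.
move=> h_gt1 /andP[x_ge1 xh].
have x_gt0 : 0 < x by lra.
have lnh_gt0 : 0 < ln h := ln_gt0 h_gt1.
have h1_gt0 : 0 < h - 1 by lra.
have xV : x * x^-1 = 1 by rewrite divff// gt_eqF.
have tanh := @ln_le_subr1 (h / x) (divr_gt0 (lt_trans ltr01 h_gt1) x_gt0).
have tan1 := @ln_le_subr1 x^-1 ltac:(by rewrite invr_gt0).
rewrite ln_div ?posrE in tanh; [|lra|by []].
rewrite lnV ?posrE// in tan1.
have : (x - 1) * ln h <= (h - 1) * ln x.
  have x1_ge0 : 0 <= x - 1 by lra.
  have hx_ge0 : 0 <= h - x by lra.
  have := lerD (ler_wpM2l x1_ge0 tanh) (ler_wpM2l hx_ge0 tan1).
  have -> : (x - 1) * (h / x - 1) + (h - x) * (x^-1 - 1) =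
            (h - 1) * (x * x^-1 - 1) by ring.
  by rewrite xV; lra.
by rewrite -ler_pdivlMr// => ?; rewrite mulrAC; lra.
Qed.

(** Gathering h ^ (1 / (h - 1)) / e into one exponential lets it merge with the geometric mean,
    which is also written as an exponential. *)
Lemma specht_ratioE h : 1 < h ->
  specht_ratio h = (h - 1) / ln h * expR ((h - 1)^-1 * ln h - 1).
Proof.
move=> h_gt1; have lnh_gt0 : 0 < ln h := ln_gt0 h_gt1.
rewrite /specht_ratio gt_eqF// /powR gt_eqF; last lra.
by rewrite expRB; field; rewrite !gt_eqF ?expR_gt0.
Qed.

(* The chord bound gives A <= 1 + k ln G with k = (h - 1) / ln h, and ln is below
   its tangent at G0 = exp (1 - 1 / k), where (1 + k ln G) / G is maximal. *)
Lemma specht_inequality_normalized h s : 1 < h -> (0 < size s)%N ->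
  {in s, forall x, 1 <= x <= h} ->
  (size s)%:R^-1 * \sum_(x <- s) x <=
    specht_ratio h * expR ((size s)%:R^-1 * \sum_(x <- s) ln x).
Proof.
move=> h_gt1 s_gt0 sP; rewrite specht_ratioE//.
have lnh_gt0 : 0 < ln h := ln_gt0 h_gt1.
set n := (size s)%:R : R; have n_gt0 : 0 < n by rewrite ltr0n.
set k := (h - 1) / ln h; have k_gt0 : 0 < k by rewrite divr_gt0//; lra.
have -> : (h - 1)^-1 * ln h = k^-1 by rewrite invf_div mulrC.
set L := n^-1 * \sum_(x <- s) ln x.
have AL : n^-1 * \sum_(x <- s) x <= 1 + k * L.
  have -> : 1 + k * L = n^-1 * \sum_(x <- s) (1 + k * ln x).
    rewrite big_split/= -mulr_sumr big_const_seq count_predT iter_addr_0 -/n /L.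
    by field; rewrite gt_eqF.
  apply: ler_wpM2l; first by rewrite invr_ge0 ltW.
  by rewrite big_seq [leRHS]big_seq ler_sum// => x /sP; apply: ln_chord_le.
apply: (le_trans AL); rewrite -mulrA -expRD.
have := ler_wpM2l (ltW k_gt0) (expR_ge1Dx (k^-1 - 1 + L)).
have -> : k * (1 + (k^-1 - 1 + L)) = 1 + k * L by field; rewrite gt_eqF.
by [].
Qed.

(** Both means are homogeneous of degree 1, so dividing every entry by [m] reduces to entries in
    [1, M / m]. *)
Lemma specht_inequality m M s : 0 < m -> m <= M -> (0 < size s)%N ->
  {in s, forall x, m <= x <= M} ->
  (size s)%:R^-1 * \sum_(x <- s) x <=
    specht_ratio (M / m) * expR ((size s)%:R^-1 * \sum_(x <- s) ln x).
Proof.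
move=> m_gt0 mM s_gt0 sP.
set n := (size s)%:R : R; have n_gt0 : 0 < n by rewrite ltr0n.
have nn (y : R) : n^-1 * (y *+ size s) = y.
  by rewrite -mulr_natl -/n mulKf// gt_eqF.
move: mM; rewrite le_eqVlt => /predU1P[mM|mM].
  (* Here h = 1, where [specht_ratio] takes its special value 1; all entries equal [m], and so do
     both means. *)
  rewrite -mM divff ?gt_eqF// /specht_ratio eqxx mul1r.
  have [k sE] : exists k, s = nseq k m.
    exists (size s); apply/all_pred1P/allP => x /sP.
    by rewrite -mM => /le_anti/esym/eqP.
  by rewrite sE size_nseq in nn *; rewrite !big_nseq !iter_addr_0 !nn lnK.
have h_gt1 : 1 < M / m by rewrite ltr_pdivlMr// mul1r.
have := @specht_inequality_normalized (M / m) [seq x / m | x <- s] h_gt1.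
rewrite size_map => /(_ s_gt0).
have sP' : {in [seq x / m | x <- s], forall x, 1 <= x <= M / m}.
  move=> _ /mapP[x /sP/andP[mx xM] ->].
  by rewrite ler_pdivlMr// mul1r mx ler_pM2r ?invr_gt0.
move=> /(_ sP'); rewrite !big_map -mulr_suml -/n.
have -> : \sum_(x <- s) ln (x / m) = \sum_(x <- s) ln x - ln m *+ size s.
  rewrite -[size s]count_predT -iter_addr_0 -big_const_seq -sumrB.
  rewrite big_seq [RHS]big_seq; apply: eq_bigr => x /sP/andP[mx _].
  by rewrite ln_div ?posrE//; lra.
by rewrite mulrBr nn expRB lnK ?posrE// !mulrA ler_pM2r// invr_gt0.
Qed.

End Specht.

(** * Growth of the Specht ratio at infinity *)

Section Asymptotics.
Variable R : realType.

Lemma ln2_gt0 : 0 < ln 2 :> R. Proof. by rewrite ln_gt0// ltr1n. Qed.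

Lemma cvgy_ln : ln x @[x --> +oo] --> (+oo : set_system R).
Proof.
apply/cvgryPge => A; near=> x.
rewrite -ler_expR lnK; first by near: x; apply: nbhs_pinfty_ge; rewrite num_real.
by rewrite posrE; near: x; apply: nbhs_pinfty_gt; rewrite num_real.
Unshelve. all: by end_near. Qed.

Lemma cvgy_inv (f : R -> R) :
  f x @[x --> +oo] --> +oo -> (f x)^-1 @[x --> +oo] --> 0.
Proof.
move=> fy; apply/gtr0_cvgV0 => //.
by have /cvgryPgt/(_ 0) := fy.
Qed.

(* [h = exp u] gives 0 <= u / (exp u - 1) <= 2 / u, since exp u >= 1 + u ^ 2 / 2. *)
Lemma cvgy_ln_div_subr1 : (h - 1)^-1 * ln h @[h --> +oo] --> (0 : R).
Proof.
have inv_ln : 2 * (ln h)^-1 @[h --> +oo] --> (0 : R).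
  by rewrite -(mulr0 2); apply: cvgMr; apply: cvgy_inv cvgy_ln.
apply: (squeeze_cvgr _ (cvg_cst 0) inv_ln); near=> h.
have h_gt1 : 1 < h by near: h; apply: nbhs_pinfty_gt; rewrite num_real.
have u_gt0 : 0 < ln h := ln_gt0 h_gt1.
have h1_gt0 : 0 < h - 1 by lra.
apply/andP; split; first by rewrite mulr_ge0// ltW// invr_gt0.
have := expR_ge1Dxn 1 (ltW u_gt0); rewrite lnK ?posrE; last lra.
rewrite (_ : 2`! = 2)%N // => hu.
rewrite [leLHS]mulrC ler_pdivrMr//.
rewrite mulrAC ler_pdivlMr//; lra.
Unshelve. all: by end_near. Qed.

(** From exp (- 1 / 6) >= 5 / 6 follows e <= (6 / 5) ^ 6 < 2.99; the same argument with 1 / 5 only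
    gives (5 / 4) ^ 5 > 3. *)
Lemma expR1_lt3 : expR 1 < 3 :> R.
Proof.
have := expR_ge1Dx (- 6^-1 : R).
have <- : expR (6^-1 : R) ^+ 6 = expR 1.
  by rewrite -expRM_natl; congr expR; lra.
rewrite expRN; set y := expR _ => y_ge.
have y_gt0 : 0 < y := expR_gt0 _.
have y_le : y <= 6 / 5.
  rewrite -(invrK y) -(invrK (6/5)) lef_pV2 ?posrE ?invr_gt0//; lra.
apply: (@le_lt_trans _ _ ((6 / 5) ^+ 6)); last by lra.
by rewrite ler_pXn2r// ?nnegrE ?(ltW y_gt0)//; lra.
Qed.

(* Hence ln (ln P) <> 0 for every prime P. *)
Lemma natr_neq_expR1 (n : nat) : n%:R != expR 1 :> R.
Proof.
case: n => [|[|[|n]]]; first by rewrite eq_sym expR_eq0.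
- by rewrite lt_eqF// (lt_trans _ (expR_gt1Dx _)) ?oner_eq0//; lra.
- by rewrite lt_eqF// (le_lt_trans _ (expR_gt1Dx _)) ?oner_eq0//; lra.
- by rewrite gt_eqF// (lt_le_trans expR1_lt3)// ler_nat.
Qed.

(** The quotient of the Specht ratio by its main term, minus 1: the asymptotic form becomes an exact
    identity, and the analytic content lies in the limit of this function. *)
Definition specht_error (x : R) : R :=
  specht_ratio (ln x / ln 2) * (expR 1 * ln 2 * ln (ln x)) / ln x - 1.

(** At x = e the main term would be 0, as the inverse of ln (ln e) = 0 is 0, while the Specht ratio
    is positive. *)
Lemma specht_errorE x : 2 <= x -> x != expR 1 ->
  specht_ratio (ln x / ln 2) =
    ln x / (expR 1 * ln 2 * ln (ln x)) * (1 + specht_error x).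
Proof.
move=> x_ge2 xNe; rewrite /specht_error addrC subrK.
have l2 := ln2_gt0; have lx : 0 < ln x by rewrite ln_gt0//; lra.
have llx : ln (ln x) != 0.
  rewrite ln_eq0//; apply: contra xNe => /eqP lx1.
  by rewrite -lx1 lnK// posrE; lra.
by field; rewrite llx !gt_eqF ?expR_gt0.
Qed.

Lemma specht_error_cvg : specht_error x @[x --> +oo] --> 0.
Proof.
(* [f] is the error in the variable h = ln x / ln 2; its last factor comes from ln (ln x) = ln h +
   ln (ln 2). *)
pose f (h : R) := (1 - h^-1) * expR ((h - 1)^-1 * ln h) *
                  (1 + ln (ln 2) * (ln h)^-1) - 1.
have l2 := ln2_gt0.
have f0 : f h @[h --> +oo] --> 0.
  have -> : 0 = (1 - 0) * expR 0 * (1 + ln (ln 2) * 0) - 1 :> R.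
    by rewrite expR0; ring.
  apply: cvgB; last exact: cvg_cst.
  apply: cvgM; first apply: cvgM.
  - by apply: cvgB; [exact: cvg_cst|apply: cvgy_inv; exact: cvg_id].
  - by apply: continuous_cvg; [exact: continuous_expR|exact: cvgy_ln_div_subr1].
  - apply: cvgD; first exact: cvg_cst.
    by apply: cvgMr; apply: cvgy_inv; exact: cvgy_ln.
have hy : ln x / ln 2 @[x --> +oo] --> (+oo : set_system R).
  by apply: gt0_cvgMly; [rewrite invr_gt0|exact: cvgy_ln].
(* The error agrees with [f] for x > 2, that is h > 1, where the exponential form of the ratio is
   available. *)
apply: cvg_trans (cvg_comp _ f hy f0); apply: near_eq_cvg; near=> x => /=.
have x_gt2 : 2 < x by near: x; apply: nbhs_pinfty_gt; rewrite num_real.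
set h := ln x / ln 2.
have lxE : ln x = h * ln 2 by rewrite /h divfK// gt_eqF.
have h_gt1 : 1 < h by rewrite /h ltr_pdivlMr// mul1r ltr_ln// posrE; lra.
have lnh := ln_gt0 h_gt1.
rewrite /specht_error -/h lxE lnM ?posrE//; last lra.
rewrite specht_ratioE// /f expRB; field.
by rewrite !gt_eqF ?expR_gt0//; lra.
Unshelve. all: by end_near. Qed.

End Asymptotics.

(** * Means of the logarithms of the prime divisors of an integer *)

Section PrimeLogMeans.
Variables (R : realType) (n : nat).
Hypothesis n_gt1 : (1 < n)%N.
Local Notation A := (log_arithmetic_mean R n).
Local Notation G := (log_geometric_mean R n).

Lemma primes_ge2 p : p \in primes n -> (2 <= p)%N.
Proof. by rewrite mem_primes => /andP[/prime_gt1]. Qed.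

Lemma ln_primes_gt0 p : p \in primes n -> 0 < ln p%:R :> R.
Proof. by move=> /primes_ge2 p_ge2; rewrite ln_gt0// ltr1n. Qed.

Lemma omega_gt0 : (0 < omega n)%N.
Proof. by rewrite lt0n size_eq0 primes_eq0 -leqNgt. Qed.

Lemma log_geometric_meanE :
  G = expR ((omega n)%:R^-1 * \sum_(p <- primes n) ln (ln p%:R)).
Proof.
have prod_gt0 : 0 < \prod_(p <- primes n) ln p%:R :> R.
  by rewrite big_seq_cond prodr_gt0// => p /andP[/ln_primes_gt0].
by rewrite /log_geometric_mean /powR gt_eqF// ln_prod//; exact: ln_primes_gt0.
Qed.

Lemma log_geometric_mean_gt0 : 0 < G.
Proof. by rewrite log_geometric_meanE expR_gt0. Qed.

Lemma ln_rad : ln (Defs.rad n)%:R = (omega n)%:R * A.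
Proof.
rewrite /log_arithmetic_mean mulVKf ?pnatr_eq0 -?lt0n ?omega_gt0//.
by rewrite /Defs.rad natr_prod ln_prod// => p /primes_ge2 p_ge2; rewrite ltr0n ltnW.
Qed.

(** Since ln (ln (p ^ w)) = ln w + ln (ln p), averaging over p leaves ln w + ln G. *)
Lemma ln_DGM_primes :
  ln (DGM [seq p%:R ^+ omega n | p <- primes n]) = (omega n)%:R * G :> R.
Proof.
have w_gt0 : 0 < (omega n)%:R :> R by rewrite ltr0n omega_gt0.
rewrite /DGM expRK size_map -/(omega n) log_geometric_meanE big_map.
(* The factor w is written exp (ln w), so that only exponents remain to be compared. *)
rewrite -{2}(lnK w_gt0) -expRD; congr expR.
transitivity ((omega n)%:R^-1 *
    \sum_(p <- primes n) (ln (omega n)%:R + ln (ln p%:R)) : R).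
  congr (_ * _); rewrite big_seq [RHS]big_seq; apply: eq_bigr => p pn.
  have lp_gt0 := ln_primes_gt0 pn.
  rewrite lnXn; last by rewrite ltr0n ltnW// primes_ge2.
  by rewrite -[ln _ *+ _]mulr_natl lnM ?posrE.
rewrite big_split/= big_const_seq count_predT iter_addr_0 mulrDr; congr (_ + _).
by rewrite -/(omega n) -[ln _ *+ _]mulr_natl mulKf// gt_eqF.
Qed.

Lemma arithmetic_le_specht_geometric :
  A <= specht_ratio (ln (max_pdiv n)%:R / ln 2) * G.
Proof.
rewrite log_geometric_meanE /log_arithmetic_mean.
have := @specht_inequality R (ln 2) (ln (max_pdiv n)%:R)
  [seq ln p%:R | p <- primes n] (ln2_gt0 R).
rewrite size_map !big_map; apply; last first.
- move=> _ /mapP[p pn ->]; have p_ge2 := primes_ge2 pn.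
  have pP := max_pdiv_max pn.
  have P_gt0 : (0 < max_pdiv n)%N by rewrite max_pdiv_gt0.
  by rewrite !ler_ln ?posrE ?ltr0n ?ler_nat ?p_ge2 ?pP// ltnW.
- exact: omega_gt0.
- rewrite ler_ln ?posrE ?ltr0n ?max_pdiv_gt0// ler_nat.
  by rewrite prime_gt1// max_pdiv_prime.
Qed.

Lemma log_arithmetic_mean_gt0 : 0 < A.
Proof.
rewrite /log_arithmetic_mean mulr_gt0 ?invr_gt0 ?ltr0n ?omega_gt0//.
(* The largest prime divisor supplies one positive summand; the others are nonnegative. *)
have := n_gt1; rewrite -pi_max_pdiv => Pn.
rewrite (big_rem _ Pn)/= ltr_wpDr ?ln_primes_gt0// big_seq.
by rewrite sumr_ge0// => p /mem_rem /ln_primes_gt0/ltW.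
Qed.

End PrimeLogMeans.

(** * Comparison of qualities and consequences of the conjecture *)

Section AbcTriples.
Variable R : realType.
Implicit Types (a b c : nat) (eps : R).
Local Notation S P := (specht_ratio (ln P / ln 2)).

Lemma abc_triple_gt1 a b c : abc_triple a b c ->
  (1 < c)%N /\ (1 < a * b * c)%N.
Proof.
case=> /and3P[a_gt0 b_gt0 _] <- _.
have c_gt1 : (1 < a + b)%N by rewrite (leq_add a_gt0 b_gt0).
by split=> //; rewrite (leq_trans c_gt1)// leq_pmull// muln_gt0 a_gt0.
Qed.

Lemma DGM_qualityE a b c : abc_triple a b c ->
  DGM_quality R a b c =
    ln c%:R / ((omega (a * b * c))%:R * log_geometric_mean R (a * b * c)).
Proof. by move=> /abc_triple_gt1[_ n_gt1]; rewrite /DGM_quality ln_DGM_primes. Qed.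

Lemma DGM_quality_ge0 a b c : abc_triple a b c -> 0 <= DGM_quality R a b c.
Proof.
move=> abc; rewrite DGM_qualityE//; have [c_gt1 n_gt1] := abc_triple_gt1 abc.
by rewrite divr_ge0 ?mulr_ge0 ?ln_ge0 ?ler1n ?(ltnW c_gt1)// ltW// log_geometric_mean_gt0.
Qed.

(** Once the positive denominators are cleared, both inequalities read ln c <= q w A. *)
Lemma standard_quality_le_iff a b c (q : R) : abc_triple a b c ->
  (standard_quality R a b c <= q) =
  (DGM_quality R a b c <= q / packing_efficiency R a b c).
Proof.
move=> abc; have [c_gt1 n_gt1] := abc_triple_gt1 abc.
rewrite DGM_qualityE// /standard_quality /packing_efficiency ln_rad//.
have A_gt0 := log_arithmetic_mean_gt0 R n_gt1.
have G_gt0 := log_geometric_mean_gt0 R (a * b * c).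
have w_gt0 : 0 < (omega (a * b * c))%:R :> R by rewrite ltr0n omega_gt0.
rewrite !ler_pdivrMr ?(mulr_gt0 w_gt0 A_gt0) ?(mulr_gt0 w_gt0 G_gt0)//.
congr (_ <= _).
by field; rewrite !gt_eqF.
Qed.

Lemma abc_conjecture_iff_DGM :
  abc_conjecture R <->
    forall eps, 0 < eps ->
      almost_all_abc_triples (fun a b c =>
        DGM_quality R a b c <= (1 + eps) / packing_efficiency R a b c).
Proof.
(* The exceptional sets coincide for each [eps] separately, so nothing is lost in [eps]. *)
suff setE eps : [set t : nat * nat * nat | abc_triple t.1.1 t.1.2 t.2 /\
      1 + eps < standard_quality R t.1.1 t.1.2 t.2] =
    [set t | abc_triple t.1.1 t.1.2 t.2 /\
      ~ DGM_quality R t.1.1 t.1.2 t.2 <=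
        (1 + eps) / packing_efficiency R t.1.1 t.1.2 t.2].
  by split=> H eps eps_gt0; have := H eps eps_gt0;
    rewrite /almost_all_abc_triples setE.
apply/seteqP; split=> -[[a b] c] /= [abc].
  by rewrite ltNge (standard_quality_le_iff _ abc) => /negP.
by rewrite ltNge (standard_quality_le_iff _ abc) => ?; split=> //; apply/negP.
Qed.

Lemma inv_packing_efficiency_le a b c : abc_triple a b c ->
  (packing_efficiency R a b c)^-1 <= S (largest_prime R a b c).
Proof.
move=> /abc_triple_gt1[_ n_gt1]; rewrite /packing_efficiency invf_div.
rewrite ler_pdivrMr ?log_geometric_mean_gt0//.
exact: arithmetic_le_specht_geometric.
Qed.

(** Exceptions to [Q'] are exceptions to [Q]. Each later consequence of the conjecture is such a
    weakening, triple by triple. *)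
Lemma almost_all_abc_triples_imply (Q Q' : nat -> nat -> nat -> Prop) :
  (forall a b c, abc_triple a b c -> Q a b c -> Q' a b c) ->
  almost_all_abc_triples Q -> almost_all_abc_triples Q'.
Proof.
move=> QQ'; apply: sub_finite_set => -[[a b] c] /= [abc nQ'].
by split=> // /(QQ' _ _ _ abc).
Qed.

Lemma abc_conjecture_DGM_le_specht eps : abc_conjecture R -> 0 < eps ->
  almost_all_abc_triples (fun a b c =>
    DGM_quality R a b c <= (1 + eps) * S (largest_prime R a b c)).
Proof.
move=> /abc_conjecture_iff_DGM abcR eps_gt0.
apply: almost_all_abc_triples_imply (abcR eps eps_gt0) => a b c abc /le_trans.
apply; rewrite ler_wpM2l ?inv_packing_efficiency_le//; lra.
Qed.

Lemma largest_prime_ge2 a b c : abc_triple a b c ->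
  2 <= largest_prime R a b c.
Proof.
by move=> /abc_triple_gt1[_ n_gt1]; rewrite ler_nat prime_gt1// max_pdiv_prime.
Qed.

(** The big-O bound must also cover small P, where the limit says nothing. Only finitely many
    integers lie below the threshold of the limit, so their values are simply added to the bound 2
    valid beyond it. *)
Lemma specht_error_nat_bounded :
  exists C : R, forall n : nat, `|1 + specht_error n%:R| <= C.
Proof.
have /cvgr0Pnorm_lt/(_ 1 ltr01)[M [_ MP]] := @specht_error_cvg R.
(* [N] exceeds |M|, so every integer n >= N lies beyond the threshold [M]. *)
pose N := (Num.truncn `|M|).+1.
exists (2 + \sum_(i < N) `|1 + specht_error i%:R|) => n.
have [nN|Nn] := ltnP n N.
  rewrite (bigD1 (Ordinal nN))//= [leRHS]addrCA lerDl addr_ge0//.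
  by rewrite sumr_ge0.
rewrite (le_trans (ler_normD _ _))// normr1 (@le_trans _ _ 2)//.
  rewrite -[leRHS]/(1 + 1) lerD2l ltW// MP// (le_lt_trans (ler_norm M))//.
  by rewrite (lt_le_trans (truncnS_gt _))// ler_nat.
by rewrite lerDl sumr_ge0.
Qed.

Lemma abc_conjecture_DGM_bigO : abc_conjecture R ->
  exists C : R, almost_all_abc_triples (fun a b c =>
    let P := largest_prime R a b c in
    `|DGM_quality R a b c| <= C * `|ln P / ln (ln P)|).
Proof.
move=> abcR; have [C CP] := specht_error_nat_bounded.
(* The 2 is 1 + eps for the choice eps = 1; e ln 2 comes from the main term of the Specht ratio. *)
pose K : R := 2 / (expR 1 * ln 2).
have K_gt0 : 0 < K by rewrite divr_gt0// mulr_gt0 ?expR_gt0 ?ln2_gt0.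
exists (K * C).
apply: almost_all_abc_triples_imply (abc_conjecture_DGM_le_specht abcR ltr01).
move=> a b c abc /=; rewrite ger0_norm ?DGM_quality_ge0// => /le_trans; apply.
set P := largest_prime R a b c.
rewrite specht_errorE ?largest_prime_ge2 ?natr_neq_expR1//.
rewrite (_ : _ * _ = K * (ln P / ln (ln P)) * (1 + specht_error P)); last first.
  by rewrite /K !invfM; ring.
(* [L] is negative at P = 2, where ln (ln 2) < 0; hence the passage to absolute values. *)
move: (ln P / ln (ln P)) => L; clearbody K; apply: (le_trans (ler_norm _)).
by rewrite !normrM gtr0_norm// -!mulrA ler_pM2l// [leLHS]mulrC ler_wpM2r// CP.
Qed.

End AbcTriples.
Theorem theorem4p15 (R : realType) :
  (abc_conjecture R <->
    forall eps : R, 0 < eps ->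
      almost_all_abc_triples (fun a b c =>
        DGM_quality R a b c <= (1 + eps) / packing_efficiency R a b c)) /\
  (exists o : R -> R,
    [/\ o x @[x --> +oo] --> 0,
        forall x : R, 2 <= x -> x != expR 1 ->
          specht_ratio (ln x / ln 2) =
            ln x / (expR 1 * ln 2 * ln (ln x)) * (1 + o x)
      & abc_conjecture R ->
          forall eps : R, 0 < eps ->
            almost_all_abc_triples (fun a b c =>
              let P := largest_prime R a b c in
              DGM_quality R a b c <= (1 + eps) * specht_ratio (ln P / ln 2) /\
              (1 + eps) * specht_ratio (ln P / ln 2) =
                (1 + eps) * (ln P / (expR 1 * ln 2 * ln (ln P))) *
                  (1 + o P))]) /\
  (abc_conjecture R ->
    exists C : R,
      almost_all_abc_triples (fun a b c =>
        let P := largest_prime R a b c in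
        `|DGM_quality R a b c| <= C * `|ln P / ln (ln P)|)).
Proof.
split; first exact: abc_conjecture_iff_DGM.
split; last exact: abc_conjecture_DGM_bigO.
exists (@specht_error R); split.
- exact: specht_error_cvg.
- exact: specht_errorE.
- move=> abcR eps eps_gt0.
  apply: almost_all_abc_triples_imply
    (abc_conjecture_DGM_le_specht abcR eps_gt0) => a b c abc le /=.
  split=> //; rewrite specht_errorE ?mulrA//.
  + exact: largest_prime_ge2.
  + exact: natr_neq_expR1.
Qed.
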